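(* Let $T$ be a tridiagonal operator on $\ell^2(\mathbb{Z}_{\ge 0})$ with coefficients $\{l_n\}_{n\ge 0},\{d_n\}_{n\ge 0},\{u_n\}_{n\ge 0}$ and $LDU$-decomposition $T=L+D+U$, such that $l_nu_n\ne 0$ holds for all $n\ge 0$, and let $z\in\mathbb{C}$ be any complex number. If $z$ is an eigenvalue of $T$, then the associated eigenspace is one-dimensional, generated by $$v_z:=\sum_{n\ge 0}\frac{p_n(z)}{\prod_{i=0}^{n-1}u_i}\,e_n.$$ Here $\{p_n(x)\}_{n\ge 0}$ is the sequence of monic polynomials defined by $$p_0(x)=1,\quad p_1(x)=x-b_0,\quad p_{n+1}(x)=(x-b_n)p_n(x)-\lambda_np_{n-1}(x)\ \ (n\ge 1),$$ with $b_n=d_n$ and $\lambda_n=u_{n-1}l_{n-1}$.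
   Context: $\ell^2(\mathbb{Z}_{\ge 0})$ is the complex Hilbert space with orthonormal basis $e_0,e_1,e_2,\ldots$. A tridiagonal operator is a linear operator $T:D(T)\subset \ell^2(\mathbb{Z}_{\ge 0})\to\ell^2(\mathbb{Z}_{\ge 0})$, defined on at least the linear span of $\{e_0,e_1,\ldots\}$, for which there are real numbers $\{l_n\}_{n\ge 0},\{d_n\}_{n\ge 0},\{u_n\}_{n\ge 0}$ with $Te_0=d_0e_0+l_0e_1$ and $Te_n=u_{n-1}e_{n-1}+d_ne_n+l_ne_{n+1}$ for $n\ge 1$. Its $LDU$-decomposition is the sum of operators $T=L+D+U$, where $Le_n=l_ne_{n+1}$, $De_n=d_ne_n$, $Ue_{n+1}=u_ne_n$ for $n\ge 0$ and $Ue_0=0$. An empty product equals $1$.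
   Formalization: The decomposition T=L+D+U is required on all of D(T), with L, D, U acting termwise on sum x_n e_n; prescribing T only on the e_n would allow arbitrary linear extensions to a larger domain, for which the claim fails. *)

(* Defs.v *)
From HB Require Import structures.
From mathcomp Require Import all_boot all_order all_algebra.
From mathcomp Require Import all_classical all_reals all_analysis.
From mathcomp Require Import complex ring.
Set Implicit Arguments.
Unset Strict Implicit.
Unset Printing Implicit Defensive.
Import Order.TTheory GRing.Theory Num.Theory.
Import numFieldNormedType.Exports.
Local Open Scope classical_set_scope.
Local Open Scope ring_scope.
Local Open Scope complex_scope.

Notation normc := ComplexField.Normc.normc.

Definition sqr_terms (R : realType) (x : nat -> R[i]) : nat -> R :=
  fun n => normc (x n) ^+ 2.

Definition square_summable (R : realType) : {pred nat -> R[i]} :=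
  fun x => `[< cvgn (series (sqr_terms x)) >].

Lemma cvg_series_finsupp (R : realType) (f : nat -> R) (N : nat) :
  (forall n, (N <= n)%N -> f n = 0) -> cvgn (series f).
Proof.
move=> f0; apply: (@cvgP _ _ (series f N)).
apply: cvg_near_cst; near=> n.
have leNn : (N <= n)%N by near: n; exact: nbhs_infty_ge.
apply/eqP; rewrite /series /= (@big_cat_nat _ _ _ N 0 n) //=.
rewrite [X in _ + X]big_nat_cond.
by rewrite [X in _ + X]big1 ?addr0 // => i; rewrite andbT => /andP[+ _]; exact: f0.
Unshelve. all: by end_near. Qed.

Lemma square_summable_submod_closed (R : realType) :
  submod_closed (@square_summable R).
Proof.
split=> [|a x y /asboolP cx /asboolP cy].
  apply/asboolP/(@cvg_series_finsupp _ _ 0) => n _.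
  by rewrite /sqr_terms ComplexField.Normc.normc0 expr0n.
apply/asboolP.
pose g n : R := (2 * normc a ^+ 2) * sqr_terms x n + 2 * sqr_terms y n.
have cg : cvgn (series g).
  have -> : series g =
      (fun n => (2 * normc a ^+ 2) * series (sqr_terms x) n
                + 2 * series (sqr_terms y) n).
    by apply/funext => n; rewrite /series /= big_split /= !mulr_sumr.
  apply: is_cvgD; apply: (@is_cvgM R _ _ _ (cst _)) => //; exact: is_cvg_cst.
apply: (series_le_cvg _ _ _ cg) => n; first exact: sqr_ge0.
  rewrite /g /sqr_terms; apply: addr_ge0; apply: mulr_ge0; rewrite ?sqr_ge0 //.
  by rewrite mulr_ge0 ?sqr_ge0.
rewrite /g /sqr_terms /=.
set p := normc (x n); set q := normc (y n); set r := normc a.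
have le_rpq : normc ((a *: x + y) n) <= r * p + q.
  have := le_normcD (a * x n) (y n).
  by rewrite ComplexField.Normc.normcM.
have ge0 (w : R[i]) : 0 <= normc w by case: w => u v; exact: sqrtr_ge0.
have rpq0 : 0 <= r * p + q by rewrite addr_ge0 ?mulr_ge0 ?ge0.
apply: (@le_trans _ _ ((r * p + q) ^+ 2)).
  by rewrite ler_sqr ?nnegrE ?ge0.
rewrite -subr_ge0.
have -> : 2 * r ^+ 2 * p ^+ 2 + 2 * q ^+ 2 - (r * p + q) ^+ 2
          = (r * p - q) ^+ 2 by ring.
exact: sqr_ge0.
Qed.

HB.instance Definition _ (R : realType) :=
  GRing.isSubmodClosed.Build R[i] (nat -> R[i])
    (@square_summable R) (@square_summable_submod_closed R).

(* The Hilbert space l^2(Z_{>=0}), as a complex vector space; [l2norm] below is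
   its Hilbert norm. *)
Record l2 (R : realType) := L2 {
  coords :> nat -> R[i];
  _ : coords \in @square_summable R }.

HB.instance Definition _ (R : realType) := [isSub for @coords R].
HB.instance Definition _ (R : realType) := [Choice of l2 R by <:].
HB.instance Definition _ (R : realType) :=
  [SubChoice_isSubLmodule of l2 R by <:].

Definition l2norm (R : realType) (x : l2 R) : R :=
  Num.sqrt (limn (series (sqr_terms x))).

Lemma delta_square_summable (R : realType) (n : nat) :
  (fun k => (k == n)%:R : R[i]) \in @square_summable R.
Proof.
apply/asboolP/(@cvg_series_finsupp _ _ n.+1) => k ltnk.
by rewrite /sqr_terms gtn_eqF // ComplexField.Normc.normc0 expr0n.
Qed.

Definition std_basis (R : realType) (n : nat) : l2 R :=
  L2 (delta_square_summable R n).

(* [v] is the sum of the series [\sum_(n >= 0) x n] in the norm of l^2. *)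
Definition l2_sum (R : realType) (x : nat -> l2 R) (v : l2 R) : Prop :=
  (fun N => l2norm (v - \sum_(n < N) x n)) @ \oo --> (0 : R).

(* A possibly unbounded operator T : D(T) -> l^2, with D(T) = [op_dom]; the
   values of [op] outside [op_dom] are irrelevant. *)
Record operator (R : realType) := Operator {
  op_dom : set (l2 R);
  op :> l2 R -> l2 R;
  op_dom0 : op_dom 0;
  op_domP : forall (a : R[i]) (x y : l2 R), op_dom x -> op_dom y ->
    op_dom (a *: x + y);
  op_linear : forall (a : R[i]) (x y : l2 R), op_dom x -> op_dom y ->
    op (a *: x + y) = a *: op x + op y }.

Definition is_tridiagonal (R : realType) (T : operator R)
    (l d u : nat -> R) : Prop :=
  [/\ forall n, op_dom T (std_basis R n),
      T (std_basis R 0) = (d 0)%:C *: std_basis R 0 + (l 0)%:C *: std_basis R 1 &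
      forall n, (1 <= n)%N ->
        T (std_basis R n) = (u n.-1)%:C *: std_basis R n.-1
                            + (d n)%:C *: std_basis R n
                            + (l n)%:C *: std_basis R n.+1].

(* L, D and U act on a vector \sum_n x_n e_n term by term, i.e. they are the
   weighted shifts (resp. diagonal operator) with the prescribed values on the
   e_n (lemmas [lower_basis] to [upper_basis0]). They are defined on all
   sequences because L x, D x and U x need not be square summable separately
   for x in D(T). *)
Definition lower (R : realType) (l : nat -> R) (x : nat -> R[i]) :
    nat -> R[i] :=
  fun n => if n is m.+1 then (l m)%:C * x m else 0.

Definition diagonal (R : realType) (d : nat -> R) (x : nat -> R[i]) :
    nat -> R[i] :=
  fun n => (d n)%:C * x n.

Definition upper (R : realType) (u : nat -> R) (x : nat -> R[i]) :
    nat -> R[i] :=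
  fun n => (u n)%:C * x n.+1.

Lemma lower_basis (R : realType) (l : nat -> R) n :
  lower l (std_basis R n) = coords ((l n)%:C *: std_basis R n.+1).
Proof.
apply/funext => -[|k]; first by symmetry; exact: mulr0.
transitivity ((l n)%:C * (k == n)%:R : R[i]); last by [].
by rewrite /lower /=; have [->//|_] := eqVneq k n; rewrite !mulr0.
Qed.

Lemma diagonal_basis (R : realType) (d : nat -> R) n :
  diagonal d (std_basis R n) = coords ((d n)%:C *: std_basis R n).
Proof.
apply/funext => k; rewrite /diagonal /=.
transitivity ((d n)%:C * (k == n)%:R : R[i]); last by [].
by have [->//|_] := eqVneq k n; rewrite !mulr0.
Qed.

Lemma upper_basis (R : realType) (u : nat -> R) n :
  upper u (std_basis R n.+1) = coords ((u n)%:C *: std_basis R n).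
Proof.
apply/funext => k; rewrite /upper /= eqSS.
transitivity ((u n)%:C * (k == n)%:R : R[i]); last by [].
by have [->//|_] := eqVneq k n; rewrite !mulr0.
Qed.

Lemma upper_basis0 (R : realType) (u : nat -> R) : upper u (std_basis R 0) = 0.
Proof. by apply/funext => k; rewrite /upper /= mulr0. Qed.

(* T = L + D + U on all of D(T). On the span of the e_n this follows from
   [is_tridiagonal], but for other vectors of D(T) it does not: an arbitrary
   linear extension of T to a larger domain may take any values there. *)
Definition LDU_decomposition (R : realType) (T : operator R)
    (l d u : nat -> R) : Prop :=
  forall x : l2 R, op_dom T x ->
    coords (T x) = lower l x + diagonal d x + upper u x.

Definition op_eigenspace (R : realType) (T : operator R) (z : R[i]) : set (l2 R) :=
  [set x | op_dom T x /\ T x = z *: x].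

Definition op_eigenvalue (R : realType) (T : operator R) (z : R[i]) : Prop :=
  exists2 x, x != 0 & op_eigenspace T z x.

(* One-dimensional with generator [v]. *)
Definition is_line (R : realType) (E : set (l2 R)) (v : l2 R) : Prop :=
  v != 0 /\ E = [set c *: v | c in [set: R[i]]].

(* The three-term recurrence; [lam 0] is not used. *)
Fixpoint three_term (R : realType) (b lam : nat -> R) (n : nat) : {poly R} :=
  match n with
  | 0 => 1
  | m.+1 =>
      match m with
      | 0 => 'X - (b 0)%:P
      | k.+1 => ('X - (b m)%:P) * three_term b lam m
                - (lam m)%:P * three_term b lam k
      end
  end.

Definition tridiag_poly (R : realType) (l d u : nat -> R) : nat -> {poly R} :=
  three_term d (fun n => u n.-1 * l n.-1).

Definition evalC (R : realType) (p : {poly R}) (z : R[i]) : R[i] :=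
  (map_poly (real_complex R) p).[z].

(* Main.v *)
Require Import Defs.
From mathcomp Require Import all_boot all_order all_algebra.
From mathcomp Require Import all_classical all_reals all_analysis.
From mathcomp Require Import complex.
From mathcomp Require Import ring.
Import Order.TTheory GRing.Theory Num.Theory.
Import numFieldNormedType.Exports.
Local Open Scope ring_scope.
Local Open Scope complex_scope.

(** Read coordinatewise, [T x = z *: x] is the three-term recurrence
      [u_n x_{n+1} = (z - d_n) x_n - l_{n-1} x_{n-1}],
    without the last term when [n = 0]. Every [u_n] is nonzero, so a solution
    is determined by [x_0]. The sequence [w_n = p_n(z) / (u_0 ... u_{n-1})]
    is the solution with [w_0 = 1] ([formal_eigenvector_step]), hence
    [x = x_0 *: w] for every eigenvector [x] ([eigenspace_coord]). A nonzero
    eigenvector [x] therefore has [x_0 != 0], which makes [w = x_0^-1 *: x]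
    square summable and an eigenvector; it spans the eigenspace. Finally, [w] is
    the norm-convergent sum of its own expansion in the standard basis, as is
    every vector of l^2 ([l2_sum_coords]). *)

(** * Expansion of a vector in the standard basis *)

Lemma l2P {R : realType} (x y : l2 R) : (forall n, x n = y n) -> x = y.
Proof. by move=> xy; apply: val_inj; apply: boolp.funext. Qed.

Lemma coords_sum {R : realType} (I : Type) (r : seq I) (P : pred I)
    (F : I -> l2 R) (k : nat) :
  (\sum_(i <- r | P i) F i) k = \sum_(i <- r | P i) F i k.
Proof. exact: (big_morph (fun y : l2 R => y k)). Qed.

Lemma coords_tail {R : realType} (v : l2 R) (N k : nat) :
  (v - \sum_(n < N) v n *: std_basis R n) k = if (k < N)%N then 0 else v k.
Proof.
transitivity (v k - (\sum_(n < N) v n *: std_basis R n) k) => [//|].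
rewrite coords_sum.
have eq_term (n : 'I_N) :
    (v n *: std_basis R n) k = if k == n :> nat then v k else 0.
  transitivity (v n * (k == n :> nat)%:R : R[i]) => [//|].
  by have [->|_] := eqVneq k (n : nat); rewrite ?mulr1 ?mulr0.
rewrite (eq_bigr _ (fun n _ => eq_term n)) -big_mkcond /=.
have [ltkN|leNk] := ltnP k N.
  by rewrite (big_pred1 (Ordinal ltkN)) ?subrr // => n; rewrite -val_eqE eq_sym.
rewrite big_pred0 ?subr0 // => n.
by rewrite gtn_eqF // (leq_trans (ltn_ord n)).
Qed.

Lemma lim_series_tail {R : realType} {f : nat -> R} (N : nat) :
  cvgn (series f) ->
  limn (series (fun k => if (k < N)%N then 0 else f k))
  = limn (series f) - series f N.
Proof.
move=> cf; apply: cvg_lim => //.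
apply: (@cvg_trans _ ((fun n => series f n - series f N) @ \oo)%classic).
  apply: near_eq_cvg; near=> n.
  have leNn : (N <= n)%N by near: n; exact: nbhs_infty_ge.
  rewrite /series /= !(@big_cat_nat _ _ _ N 0 n) //= addrAC subrr add0r.
  rewrite big_nat [X in _ = X + _]big_nat.
  rewrite [X in _ = X + _]big1 ?add0r => [|i /andP[_ ->] //].
  rewrite -big_nat; apply: eq_big_nat => i /andP[leNi _].
  by rewrite ltnNge leNi.
by apply: cvgB; [exact: cf | exact: cvg_cst].
Unshelve. all: by end_near. Qed.

Lemma l2_sum_coords {R : realType} (v : l2 R) :
  l2_sum (fun n => v n *: std_basis R n) v.
Proof.
have cv : cvgn (series (sqr_terms v)) by apply/asboolP; exact: (valP v).
rewrite /l2_sum.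
have -> : (fun N => l2norm (v - \sum_(n < N) v n *: std_basis R n)) =
    (fun N => Num.sqrt (limn (series (sqr_terms v)) - series (sqr_terms v) N)).
  apply: boolp.funext => N; rewrite /l2norm -lim_series_tail //.
  congr (Num.sqrt (limn (series _))); apply: boolp.funext => k.
  rewrite /sqr_terms coords_tail; case: ifP => // _.
  by rewrite ComplexField.Normc.normc0 expr0n.
have -> : 0 =
    Num.sqrt (limn (series (sqr_terms v)) - limn (series (sqr_terms v))).
  by rewrite subrr sqrtr0.
apply: continuous_cvg; first exact: sqrt_continuous.
by apply: cvgB; [exact: cvg_cst | exact: cv].
Qed.

(** * The recurrence for the coordinates of an eigenvector *)

(** The coordinates of [v_z]; they need not be square summable for general
    [z]. *)
Definition formal_eigenvector {R : realType} (l d u : nat -> R) (z : R[i])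
    (n : nat) : R[i] :=
  evalC (tridiag_poly l d u n) z / (\prod_(i < n) u i)%:C.

Lemma tridiag_poly_rec {R : realType} (l d u : nat -> R) (n : nat) :
  tridiag_poly l d u n.+2 =
    ('X - (d n.+1)%:P) * tridiag_poly l d u n.+1
    - (u n * l n)%:P * tridiag_poly l d u n.
Proof. by []. Qed.

Section Recurrence.
Context {R : realType} (l d u : nat -> R) (z : R[i]).
Hypothesis u_neq0 : forall n, u n != 0.

Local Notation w := (formal_eigenvector l d u z).

Let uC_neq0 n : (u n)%:C != 0 :> R[i].
Proof. by rewrite fmorph_eq0. Qed.

Let prodC_neq0 n : (\prod_(i < n) u i)%:C != 0 :> R[i].
Proof. by rewrite fmorph_eq0; apply/prodf_neq0 => i _. Qed.

Lemma formal_eigenvector0 : w 0 = 1.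
Proof.
by rewrite /formal_eigenvector big_ord0 /evalC /= rmorph1 hornerC divr1.
Qed.

Lemma formal_eigenvector1 : (u 0)%:C * w 1 = z - (d 0)%:C.
Proof.
rewrite /formal_eigenvector big_ord1 /evalC /=.
by rewrite rmorphB /= map_polyX map_polyC !hornerE /= mulrAC mulfV ?mul1r.
Qed.

Lemma formal_eigenvector_step n :
  (u n.+1)%:C * w n.+2 = (z - (d n.+1)%:C) * w n.+1 - (l n)%:C * w n.
Proof.
rewrite /formal_eigenvector tridiag_poly_rec /evalC.
rewrite rmorphB !rmorphM /= rmorphB /= map_polyX !map_polyC !hornerE /=.
rewrite !big_ord_recr /= !rmorphM /=.
by field; rewrite !uC_neq0 prodC_neq0.
Qed.

(** A solution of the recurrence is determined by its initial coordinate. *)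
Lemma recurrence_coord (x : nat -> R[i]) :
  (d 0)%:C * x 0 + (u 0)%:C * x 1 = z * x 0 ->
  (forall n, (l n)%:C * x n + (d n.+1)%:C * x n.+1 + (u n.+1)%:C * x n.+2
             = z * x n.+1) ->
  forall n, x n = x 0 * w n.
Proof.
move=> x1E xE n.
suff [] : x n = x 0 * w n /\ x n.+1 = x 0 * w n.+1 by [].
elim: n => [|n [IH0 IH1]].
  split; first by rewrite formal_eigenvector0 mulr1.
  apply: (mulfI (uC_neq0 0)); rewrite mulrCA formal_eigenvector1.
  by rewrite mulrBr [x 0 * z]mulrC -x1E; ring.
split=> //; apply: (mulfI (uC_neq0 n.+1)).
rewrite mulrCA formal_eigenvector_step.
have -> : (u n.+1)%:C * x n.+2 =
    z * x n.+1 - (l n)%:C * x n - (d n.+1)%:C * x n.+1 by rewrite -xE; ring.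
by rewrite IH0 IH1; ring.
Qed.

End Recurrence.

(** * Eigenspaces *)

Lemma eigenspace_coord {R : realType} {T : operator R} {l d u : nat -> R}
    {z : R[i]} {x : l2 R} :
  LDU_decomposition T l d u -> (forall n, u n != 0) ->
  op_eigenspace T z x -> forall n, x n = x 0 * formal_eigenvector l d u z n.
Proof.
move=> lduT u_neq0 [domx Tx].
have eqx n : lower l x n + Defs.diagonal d x n + upper u x n = z * x n.
  by have := congr1 (fun y => coords y n) Tx; rewrite (lduT _ domx).
apply: recurrence_coord => // [|n]; last exact: (eqx n.+1).
by have := eqx 0; rewrite /lower add0r.
Qed.

Lemma op_eigenspaceZ {R : realType} {T : operator R} {z : R[i]} (a : R[i])
    {x : l2 R} :
  op_eigenspace T z x -> op_eigenspace T z (a *: x).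
Proof.
move=> [domx Tx]; have dom0 := op_dom0 T.
have T0 : T 0 = 0.
  by have := op_linear (-1) dom0 dom0; rewrite scaler0 addr0 scaleN1r addNr.
rewrite -[a *: x]addr0; split; first exact: op_domP.
by rewrite op_linear // T0 !addr0 Tx !scalerA mulrC.
Qed.

Theorem theorem4p1 (R : realType) (T : operator R) (l d u : nat -> R)
    (tridT : is_tridiagonal T l d u)
    (lduT : LDU_decomposition T l d u)
    (lu_neq0 : forall n : nat, l n * u n != 0)
    (z : R[i]) (eigz : op_eigenvalue T z) :
  exists2 v_z : l2 R,
    l2_sum (fun n => (evalC (tridiag_poly l d u n) z
                      / (\prod_(i < n) u i)%:C) *: std_basis R n) v_z
    & is_line (op_eigenspace T z) v_z.
Proof.
have u_neq0 n : u n != 0.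
  by have := lu_neq0 n; rewrite mulf_eq0 negb_or => /andP[].
have [x x_neq0 Ex] := eigz.
have x0_neq0 : x 0 != 0.
  apply: contraNneq x_neq0 => x00; apply/eqP/l2P => n.
  by rewrite (eigenspace_coord lduT u_neq0 Ex) x00 mul0r.
pose v := (x 0)^-1 *: x.
have vE n : v n = formal_eigenvector l d u z n.
  transitivity ((x 0)^-1 * x n) => [//|].
  by rewrite (eigenspace_coord lduT u_neq0 Ex n) mulKf.
have Ev : op_eigenspace T z v by exact: op_eigenspaceZ.
exists v.
  have -> : (fun n => (evalC (tridiag_poly l d u n) z
      / (\prod_(i < n) u i)%:C) *: std_basis R n)
    = (fun n => v n *: std_basis R n) by apply: boolp.funext => n; rewrite vE.
  exact: l2_sum_coords.
split; first by rewrite scaler_eq0 invr_eq0 negb_or x0_neq0.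
apply/seteqP; split=> [y Ey|_ [c _ <-]]; last exact: op_eigenspaceZ.
exists (y 0) => //; apply: l2P => n.
by rewrite (eigenspace_coord lduT u_neq0 Ey n) -vE.
Qed.
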